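(* Let $p\ge2$ be an integer. Up to isomorphism there exist exactly $4p^2$ simple left modules over the Drinfeld double $\mathcal{D}=\mathcal{D}(\mathcal{H}_{p,-1}^{cop})$: the $2p$ one-dimensional modules $\Bbbk_{\chi^i}$, $i\in\{0,\dots,2p-1\}$, and the $4p^2-2p$ two-dimensional modules $V_{i,j}$, $(i,j)\in\Lambda_p$.
   Context: $\Bbbk$ is an algebraically closed field of characteristic zero, $\xi\in\Bbbk$ is a primitive $2p$-th root of unity, $\lambda=\frac{\xi-1}{\xi+1}$, and $\theta\in\Bbbk$ is fixed with $\theta^2=(1-\xi^{-2})\lambda$. The Hopf algebra $\mathcal{H}_{p,-1}$ is generated as an algebra by $a,b$ with relations $a^{2p}=1$, $b^2=0$, $ba=\xi ab$; its coalgebra structure is $\Delta(a)=a\otimes a+\lambda^{-1}b\otimes ba^p$, $\Delta(b)=b\otimes a^{p+1}+a\otimes b$, $\epsilon(a)=1$, $\epsilon(b)=0$. Its dual is isomorphic to the Radford algebra generated by $g,x$ with $g^{2p}=1$, $x^2=1-g^2$, $gx=-xg$, where, with respect to the basis of $\mathcal{H}_{p,-1}^*$ dual to the basis $\{a^l, ba^l\mid 0\le l\le 2p-1\}$ of $\mathcal{H}_{p,-1}$, $g=\sum_{l=0}^{2p-1}\xi^{-l}(a^l)^*$ and $x=\theta\sum_{l=0}^{2p-1}(ba^l)^*$. As an algebra, the Drinfeld double $\mathcal{D}=\mathcal{D}(\mathcal{H}_{p,-1}^{cop})$ (of dimension $16p^2$) is generated by $a,b,g,x$ with relations $a^{2p}=1$,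 $b^2=0$, $ba=\xi ab$, $g^{2p}=1$, $x^2=1-g^2$, $gx=-xg$, $ag=ga$, $bg=-gb$, $ax-\xi xa=\lambda^{-1}\theta\xi^{p+1}(ba^p-gb)$, $bx-\xi xb=\theta\xi^{p+1}(a^{p+1}-ga)$. $\Bbbk_{\chi^i}$ is the one-dimensional $\mathcal{D}$-module on which $a\mapsto\xi^i$, $b\mapsto0$, $g\mapsto(-1)^i$, $x\mapsto0$. $\Lambda_p=\{(i,j)\in\{0,\dots,2p-1\}^2: pi-j\not\equiv0\bmod 2p\}$. For $(i,j)\in\Lambda_p$, $V_{i,j}$ is the two-dimensional $\mathcal{D}$-module on which $a\mapsto\begin{pmatrix}\xi^i&0\\0&\xi^{i+1}\end{pmatrix}$, $b\mapsto\begin{pmatrix}0&1\\0&0\end{pmatrix}$, $g\mapsto\begin{pmatrix}\xi^j&0\\0&-\xi^j\end{pmatrix}$, $x\mapsto\begin{pmatrix}0&\theta^{-1}\xi^{p-1-i}((-1)^i+\xi^j)\\ \theta\xi^{p+1+i}((-1)^i-\xi^j)&0\end{pmatrix}$. *)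

(* Defs.v *)
From HB Require Import structures.
From mathcomp Require Import all_boot all_order all_algebra.
From mathcomp Require Import generic_quotient.
From mathcomp.classical Require Import boolp.
From mathcomp.multinomials Require Import monalg.
From mathcomp Require Import ring.

Set Implicit Arguments.
Unset Strict Implicit.
Unset Printing Implicit Defensive.

Import GRing.Theory.
Local Open Scope ring_scope.
Local Open Scope quotient_scope.

Section ModuleNotions.
Variable R : pzRingType.

Definition simple_module (M : lmodType R) : Prop :=
  (exists v : M, v != 0) /\
  forall N : {pred M}, submod_closed N ->
    (forall v, (v \in N) = (v == 0)) \/ (forall v, v \in N).

Definition module_iso (M N : lmodType R) : Prop :=
  exists f : {linear M -> N}, bijective f.

(* S is a complete irredundant list of the isomorphism classes of simple
   left R-modules. *)
Definition classifies_simples (I : Type) (S : I -> lmodType R) : Prop :=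
  [/\ forall i, simple_module (S i),
      forall i j, module_iso (S i) (S j) -> i = j
    & forall M : lmodType R, simple_module M -> exists i, module_iso M (S i)].

End ModuleNotions.

(* mathcomp only provides quotients of commutative rings. *)
Section RingQuotient.
Variables (R : nzRingType) (S : seq R).

Inductive two_sided_ideal : R -> Prop :=
| tsi_zero : two_sided_ideal 0
| tsi_step u r v y : r \in S -> two_sided_ideal y ->
    two_sided_ideal (u * r * v + y).

Lemma tsiD x y :
  two_sided_ideal x -> two_sided_ideal y -> two_sided_ideal (x + y).
Proof.
move=> Ix Iy; elim: Ix => [|u r v z rS _ IH]; first by rewrite add0r.
by rewrite -addrA; apply: tsi_step.
Qed.

Lemma tsiMl z x : two_sided_ideal x -> two_sided_ideal (z * x).
Proof.
elim=> [|u r v y rS _ IH]; first by rewrite mulr0; apply: tsi_zero.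
by rewrite mulrDr !mulrA; apply: tsi_step.
Qed.

Lemma tsiMr z x : two_sided_ideal x -> two_sided_ideal (x * z).
Proof.
elim=> [|u r v y rS _ IH]; first by rewrite mul0r; apply: tsi_zero.
by rewrite mulrDl -(mulrA (u * r)); apply: tsi_step.
Qed.

Lemma tsiN x : two_sided_ideal x -> two_sided_ideal (- x).
Proof. by move=> Ix; rewrite -mulN1r; apply: tsiMl. Qed.

Lemma tsi_gen r : r \in S -> two_sided_ideal r.
Proof.
move=> rS; have := tsi_step 1 1 rS tsi_zero.
by rewrite mul1r mulr1 addr0.
Qed.

Definition tsi_eq : rel R := fun x y => `[< two_sided_ideal (x - y) >].

Lemma tsi_eq_is_equiv : equiv_class_of tsi_eq.
Proof.
split=> [x|x y|y x z].
- by apply/asboolP; rewrite subrr; apply: tsi_zero.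
- by apply/asboolP/asboolP => /tsiN; rewrite opprB.
- move=> /asboolP h1 /asboolP h2; apply/asboolP.
  by have := tsiD h1 h2; rewrite addrA subrK.
Qed.

Canonical tsi_eq_equiv := EquivRelPack tsi_eq_is_equiv.
Canonical tsi_eq_encModRel := defaultEncModRel tsi_eq.

Definition ring_quot := {eq_quot tsi_eq}.

HB.instance Definition _ : EqQuotient R tsi_eq ring_quot :=
  EqQuotient.on ring_quot.
HB.instance Definition _ := Choice.on ring_quot.

Definition rq_pi (x : R) : ring_quot := \pi x.

Lemma rq_piP x y : rq_pi x = rq_pi y <-> two_sided_ideal (x - y).
Proof.
split; first by move=> /eqquotP /asboolP.
by move=> h; apply/eqquotP/asboolP.
Qed.

Lemma rq_reprK (q : ring_quot) : rq_pi (repr q) = q.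
Proof. exact: reprK. Qed.

Lemma rq_repr_pi x : two_sided_ideal (repr (rq_pi x) - x).
Proof. by apply/rq_piP; rewrite rq_reprK. Qed.

Definition rq_add (x y : ring_quot) := rq_pi (repr x + repr y).
Definition rq_opp (x : ring_quot) := rq_pi (- repr x).
Definition rq_mul (x y : ring_quot) := rq_pi (repr x * repr y).

Lemma rq_addE x y : rq_add (rq_pi x) (rq_pi y) = rq_pi (x + y).
Proof.
by apply/rq_piP; rewrite opprD addrACA; apply: tsiD; apply: rq_repr_pi.
Qed.

Lemma rq_oppE x : rq_opp (rq_pi x) = rq_pi (- x).
Proof. by apply/rq_piP; rewrite -opprD; apply/tsiN/rq_repr_pi. Qed.

Lemma rq_mulE x y : rq_mul (rq_pi x) (rq_pi y) = rq_pi (x * y).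
Proof.
apply/rq_piP; set x' := repr _; set y' := repr _.
have -> : x' * y' - x * y = (x' - x) * y' + x * (y' - y).
  by rewrite mulrBl mulrBr addrA subrK.
by apply: tsiD; [apply: tsiMr|apply: tsiMl]; apply: rq_repr_pi.
Qed.

Lemma rq_ind (P : ring_quot -> Prop) :
  (forall x, P (rq_pi x)) -> forall q, P q.
Proof. by move=> h q; rewrite -(rq_reprK q). Qed.

Lemma rq_addA : associative rq_add.
Proof. by do 3!elim/rq_ind=> ?; rewrite !rq_addE addrA. Qed.
Lemma rq_addC : commutative rq_add.
Proof. by do 2!elim/rq_ind=> ?; rewrite !rq_addE addrC. Qed.
Lemma rq_add0 : left_id (rq_pi 0) rq_add.
Proof. by elim/rq_ind=> ?; rewrite rq_addE add0r. Qed.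
Lemma rq_addN : left_inverse (rq_pi 0) rq_opp rq_add.
Proof. by elim/rq_ind=> ?; rewrite rq_oppE rq_addE addNr. Qed.

HB.instance Definition _ :=
  GRing.isZmodule.Build ring_quot rq_addA rq_addC rq_add0 rq_addN.

Lemma rq_mulA : associative rq_mul.
Proof. by do 3!elim/rq_ind=> ?; rewrite !rq_mulE mulrA. Qed.
Lemma rq_mul1l : left_id (rq_pi 1) rq_mul.
Proof. by elim/rq_ind=> ?; rewrite rq_mulE mul1r. Qed.
Lemma rq_mul1r : right_id (rq_pi 1) rq_mul.
Proof. by elim/rq_ind=> ?; rewrite rq_mulE mulr1. Qed.
Lemma rq_mulDl : left_distributive rq_mul +%R.
Proof.
do 3!elim/rq_ind=> ?.
by rewrite ![_ + _]rq_addE !rq_mulE [RHS]rq_addE mulrDl.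
Qed.
Lemma rq_mulDr : right_distributive rq_mul +%R.
Proof.
do 3!elim/rq_ind=> ?.
by rewrite ![_ + _]rq_addE !rq_mulE [RHS]rq_addE mulrDr.
Qed.

HB.instance Definition _ := GRing.Zmodule_isPzRing.Build ring_quot
  rq_mulA rq_mul1l rq_mul1r rq_mulDl rq_mulDr.

Lemma rq_piB : zmod_morphism rq_pi.
Proof. by move=> x y; rewrite -rq_addE -rq_oppE. Qed.
Lemma rq_piM : monoid_morphism rq_pi.
Proof. by split=> // x y; rewrite -rq_mulE. Qed.

HB.instance Definition _ := GRing.isZmodMorphism.Build R ring_quot rq_pi rq_piB.
HB.instance Definition _ := GRing.isMonoidMorphism.Build R ring_quot rq_pi rq_piM.

Section Lift.
Variables (T : pzRingType) (f : {rmorphism R -> T}).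
Hypothesis fS : forall r, r \in S -> f r = 0.

Lemma tsi_ker x : two_sided_ideal x -> f x = 0.
Proof.
elim=> [|u r v y rS _ IH]; first exact: rmorph0.
by rewrite rmorphD !rmorphM /= (fS rS) mulr0 mul0r add0r.
Qed.

Definition rq_lift (_ : forall r, r \in S -> f r = 0) (q : ring_quot) : T :=
  f (repr q).

Lemma rq_liftE x : rq_lift fS (rq_pi x) = f x.
Proof. by apply/eqP; rewrite -subr_eq0 -rmorphB; apply/eqP/tsi_ker/rq_repr_pi. Qed.

Lemma rq_liftB : zmod_morphism (rq_lift fS).
Proof.
by do 2!elim/rq_ind=> ?; rewrite -rmorphB !rq_liftE rmorphB.
Qed.
Lemma rq_liftM : monoid_morphism (rq_lift fS).
Proof.
split; first by rewrite -(rmorph1 rq_pi) rq_liftE rmorph1.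
by do 2!elim/rq_ind=> ?; rewrite -rmorphM !rq_liftE rmorphM.
Qed.

HB.instance Definition _ :=
  GRing.isZmodMorphism.Build ring_quot T (rq_lift fS) rq_liftB.
HB.instance Definition _ :=
  GRing.isMonoidMorphism.Build ring_quot T (rq_lift fS) rq_liftM.
End Lift.

End RingQuotient.

Section FreeAlgebra.
Variables (k : fieldType) (n : nat).

Definition free_algebra := {malg k[{fmonom 'I_n}]}.
HB.instance Definition _ := GRing.Lalgebra.on free_algebra.

Definition free_gen (i : 'I_n) : free_algebra := << fmu i >>.

Definition free_scalar (c : k) : free_algebra := c%:A.

Section Eval.
Variables (m : nat) (A : 'I_n -> 'M[k]_m.+1).

Definition word_eval (w : {fmonom 'I_n}) : 'M[k]_m.+1 :=
  \prod_(i <- (w : seq _)) A i.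

Lemma word_eval_morph : mmorphism word_eval.
Proof.
split=> [x y|]; first by rewrite /word_eval fmM big_cat.
by rewrite /word_eval fm1 big_nil.
Qed.
HB.instance Definition _ := monalg.isMultiplicative.Build _ _ word_eval word_eval_morph.

Definition free_eval : free_algebra -> 'M[k]_m.+1 := mmap scalar_mx word_eval.

Lemma free_evalB : zmod_morphism free_eval.
Proof. by move=> x y; apply: mmapB. Qed.
Lemma free_evalM : monoid_morphism free_eval.
Proof.
have [h1 h2] : GRing.multiplicative free_eval.
  apply: commr_mmap_is_multiplicative => g w w'.
  by rewrite /GRing.comm /= -!mulmxE scalar_mxC.
by split.
Qed.
HB.instance Definition _ :=
  GRing.isZmodMorphism.Build free_algebra 'M[k]_m.+1 free_eval free_evalB.
HB.instance Definition _ :=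
  GRing.isMonoidMorphism.Build free_algebra 'M[k]_m.+1 free_eval free_evalM.

Lemma free_evalZ c x : free_eval (c *: x) = c *: free_eval x.
Proof. by rewrite /free_eval mmapZ /= -mulmxE mul_scalar_mx. Qed.

Lemma free_eval_gen i : free_eval (free_gen i) = A i.
Proof.
by rewrite /free_eval mmapU /= /word_eval fmU big_seq1 mul1r.
Qed.
End Eval.
End FreeAlgebra.

Lemma free_scalarC (k : fieldType) (n : nat) (c : k) (x : free_algebra k n) :
  free_scalar n c * x = x * free_scalar n c.
Proof.
have -> : free_scalar n c = c%:MP by rewrite /free_scalar -mul_malgC mulr1.
rewrite [LHS]fgmulUg [RHS]fgmulgU; apply: eq_bigr => w _.
by rewrite mulrC mul1m mulm1.
Qed.

(* p * i - j is nonzero modulo 2p. *)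
Definition Lambda (p : nat) : finType :=
  {ij : ('I_(2 * p) * 'I_(2 * p))%type | (p * ij.1 != ij.2 %[mod 2 * p])%N}.

Section Double.
Variables (k : fieldType) (p : nat) (xi theta : k).

Definition lambda : k := (xi - 1) / (xi + 1).

(* Each entry is (left-hand side) - (right-hand side) of a defining relation. *)
Definition double_rels (A : lalgType k) (a b g x : A) : seq A :=
  [:: a ^+ (2 * p) - 1;
      b ^+ 2;
      b * a - xi *: (a * b);
      g ^+ (2 * p) - 1;
      x ^+ 2 - (1 - g ^+ 2);
      g * x - (- (x * g));
      a * g - g * a;
      b * g - (- (g * b));
      (a * x - xi *: (x * a))
        - (lambda^-1 * theta * xi ^+ p.+1) *: (b * a ^+ p - g * b);
      (b * x - xi *: (x * b))
        - (theta * xi ^+ p.+1) *: (a ^+ p.+1 - g * a)].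

Lemma map_double_rels (A A' : lalgType k) (f : {rmorphism A -> A'})
    (fZ : forall c u, f (c *: u) = c *: f u) a b g x :
  map f (double_rels a b g x) = double_rels (f a) (f b) (f g) (f x).
Proof.
by rewrite /double_rels /= !(rmorphB, rmorphN, fZ, rmorphM, rmorphXn, rmorph1).
Qed.

Definition gen_a : 'I_4 := @Ordinal 4 0 isT.
Definition gen_b : 'I_4 := @Ordinal 4 1 isT.
Definition gen_g : 'I_4 := @Ordinal 4 2 isT.
Definition gen_x : 'I_4 := @Ordinal 4 3 isT.

Definition double_ideal_gens : seq (free_algebra k 4) :=
  double_rels (free_gen k gen_a) (free_gen k gen_b)
              (free_gen k gen_g) (free_gen k gen_x).

(* The Drinfeld double of H_{p,-1}^cop as an algebra: the quotient of the free
   algebra k<a, b, g, x> by the two-sided ideal of its defining relations.  The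
   subalgebras generated by a, b and by g, x are H_{p,-1} and its dual.  The
   coalgebra structure plays no role for modules and is not defined. *)
Definition double : Type := ring_quot double_ideal_gens.
HB.instance Definition _ := GRing.PzRing.on double.

Definition double_pi (f : free_algebra k 4) : double := rq_pi double_ideal_gens f.
HB.instance Definition _ := GRing.isZmodMorphism.Build (free_algebra k 4) double
  double_pi (@rq_piB _ double_ideal_gens).
HB.instance Definition _ := GRing.isMonoidMorphism.Build (free_algebra k 4) double
  double_pi (@rq_piM _ double_ideal_gens).

Definition da : double := double_pi (free_gen k gen_a).
Definition db : double := double_pi (free_gen k gen_b).
Definition dg : double := double_pi (free_gen k gen_g).
Definition dx : double := double_pi (free_gen k gen_x).

(* The structure map k -> double of the k-algebra. *)
Definition double_scalar (c : k) : double := double_pi (free_scalar 4 c).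

Lemma double_scalarB : zmod_morphism double_scalar.
Proof. by move=> c d; rewrite /double_scalar /free_scalar scalerBl rmorphB. Qed.
Lemma double_scalarM : monoid_morphism double_scalar.
Proof.
split; first by rewrite /double_scalar /free_scalar scale1r rmorph1.
move=> c d; rewrite /double_scalar -rmorphM; congr (double_pi _).
by rewrite /free_scalar -scalerAl mul1r scalerA.
Qed.
HB.instance Definition _ :=
  GRing.isZmodMorphism.Build k double double_scalar double_scalarB.
HB.instance Definition _ :=
  GRing.isMonoidMorphism.Build k double double_scalar double_scalarM.

Lemma double_scalarC c (d : double) : double_scalar c * d = d * double_scalar c.
Proof.
elim/rq_ind: d => f; rewrite -/(double_pi f) /double_scalar -!rmorphM /=.
by rewrite free_scalarC.
Qed.

Definition has_kdim (M : lmodType double) (n : nat) : Prop :=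
  exists f : 'cV[k]_n -> M,
    bijective f /\
    forall c v w, f (c *: v + w) = double_scalar c *: f v + f w.

Section MatrixModule.
Variables (n : nat) (A B G X : 'M[k]_n.+1).

Definition matrix_rels : Prop := forall r, r \in double_rels A B G X -> r = 0.

Definition gen_images (i : 'I_4) : 'M[k]_n.+1 :=
  match val i with 0 => A | 1 => B | 2 => G | _ => X end.

Lemma double_eval_kills (h : matrix_rels) (r : free_algebra k 4) :
  r \in double_ideal_gens -> free_eval gen_images r = 0.
Proof.
move=> rI; apply: h; have := map_f (free_eval gen_images) rI.
rewrite (map_double_rels (free_evalZ gen_images)).
by rewrite /= !free_eval_gen.
Qed.

Definition double_eval (h : matrix_rels) : double -> 'M[k]_n.+1 :=
  rq_lift (double_eval_kills h).
HB.instance Definition _ (h : matrix_rels) := GRing.isZmodMorphism.Build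
  double 'M[k]_n.+1 (double_eval h) (rq_liftB (double_eval_kills h)).
HB.instance Definition _ (h : matrix_rels) := GRing.isMonoidMorphism.Build
  double 'M[k]_n.+1 (double_eval h) (rq_liftM (double_eval_kills h)).

(* Column vectors k^(n+1), with a, b, g, x acting by left multiplication by
   A, B, G, X. *)
Definition matrix_module (h : matrix_rels) : Type := 'cV[k]_n.+1.

Variable h : matrix_rels.

HB.instance Definition _ := GRing.Zmodule.on (matrix_module h).

Definition matrix_module_scale (d : double) (v : matrix_module h) :
  matrix_module h := double_eval h d *m (v : 'cV[k]_n.+1).

Lemma matrix_module_scaleA d e v :
  matrix_module_scale d (matrix_module_scale e v) = matrix_module_scale (d * e) v.
Proof. by rewrite /matrix_module_scale mulmxA rmorphM. Qed.
Lemma matrix_module_scale1 : left_id 1 matrix_module_scale.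
Proof. by move=> v; rewrite /matrix_module_scale rmorph1 mul1mx. Qed.
Lemma matrix_module_scaleDr : right_distributive matrix_module_scale +%R.
Proof. by move=> d v w; rewrite /matrix_module_scale mulmxDr. Qed.
Lemma matrix_module_scaleDl v :
  {morph matrix_module_scale^~ v : d e / d + e}.
Proof. by move=> d e; rewrite /matrix_module_scale rmorphD mulmxDl. Qed.

HB.instance Definition _ := GRing.Zmodule_isLmodule.Build double (matrix_module h)
  matrix_module_scaleA matrix_module_scale1 matrix_module_scaleDr
  matrix_module_scaleDl.

Lemma double_eval_gen i :
  double_eval h (double_pi (free_gen k i)) = gen_images i.
Proof. by rewrite /double_eval rq_liftE /= free_eval_gen. Qed.

Lemma matrix_module_aE (v : matrix_module h) : da *: v = A *m (v : 'cV[k]_n.+1).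
Proof. by congr (_ *m _); apply: double_eval_gen. Qed.
Lemma matrix_module_bE (v : matrix_module h) : db *: v = B *m (v : 'cV[k]_n.+1).
Proof. by congr (_ *m _); apply: double_eval_gen. Qed.
Lemma matrix_module_gE (v : matrix_module h) : dg *: v = G *m (v : 'cV[k]_n.+1).
Proof. by congr (_ *m _); apply: double_eval_gen. Qed.
Lemma matrix_module_xE (v : matrix_module h) : dx *: v = X *m (v : 'cV[k]_n.+1).
Proof. by congr (_ *m _); apply: double_eval_gen. Qed.

Lemma matrix_module_scalarE c (v : matrix_module h) :
  double_scalar c *: v = c *: (v : 'cV[k]_n.+1).
Proof.
rewrite -mul_scalar_mx; congr (_ *m _).
by rewrite /double_eval rq_liftE /= free_evalZ rmorph1 scalemx1.
Qed.

End MatrixModule.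

Definition chi_mx_a (i : nat) : 'M[k]_1 := (xi ^+ i)%:M.
Definition chi_mx_b : 'M[k]_1 := 0.
Definition chi_mx_g (i : nat) : 'M[k]_1 := ((-1) ^+ i)%:M.
Definition chi_mx_x : 'M[k]_1 := 0.

Definition mx2 (e11 e12 e21 e22 : k) : 'M[k]_2 :=
  \matrix_(r, s) if r == 0 then (if s == 0 then e11 else e12)
                 else (if s == 0 then e21 else e22).

Definition V_mx_a (i : nat) := mx2 (xi ^+ i) 0
                                   0         (xi ^+ i.+1).
Definition V_mx_b           := mx2 0 1
                                   0 0.
Definition V_mx_g (j : nat) := mx2 (xi ^+ j) 0
                                   0         (- xi ^+ j).
(* The exponent p - 1 - i may be negative: it is an int. *)
Definition V_mx_x (i j : nat) :=
  mx2 0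
      (theta^-1 * xi ^ (p%:Z - 1 - i%:Z) * ((-1) ^+ i + xi ^+ j))
      (theta * xi ^+ (p + 1 + i) * ((-1) ^+ i - xi ^+ j))
      0.

Hypotheses (p_ge2 : (2 <= p)%N) (xi_prim : (2 * p).-primitive_root xi)
  (theta2 : theta ^+ 2 = (1 - xi ^- 2) * lambda).

Lemma xi_p : xi ^+ p = -1.
Proof.
have h : (xi ^+ p - 1) * (xi ^+ p + 1) = 0.
  by rewrite -subr_sqr expr1n -exprM mulnC (prim_expr_order xi_prim) subrr.
move/eqP: h; rewrite mulf_eq0 subr_eq0 addr_eq0 => /orP[|/eqP //].
rewrite -(prim_order_dvd xi_prim) => /dvdn_leq.
move/(_ (ltnW p_ge2)); rewrite mul2n -addnn -[X in (_ <= X)%N]addn0.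
by rewrite leq_add2l leqNgt (ltnW p_ge2).
Qed.

Lemma xi_neq0 : xi != 0.
Proof.
by rewrite (prim_root_eq0 xi_prim) muln_eq0 /= -lt0n (ltnW p_ge2).
Qed.

Lemma xi2_neq1 : xi ^+ 2 != 1.
Proof.
apply/negP; rewrite -(prim_order_dvd xi_prim) => /dvdn_leq => /(_ isT).
by rewrite -[X in (_ <= X)%N]muln1 leq_mul2l /= leqNgt p_ge2.
Qed.

Lemma xi_neq1 : xi - 1 != 0.
Proof.
by rewrite subr_eq0; apply: contraNneq xi2_neq1 => ->; rewrite expr1n.
Qed.

Lemma xi_neqN1 : xi + 1 != 0.
Proof.
by rewrite addr_eq0; apply: contraNneq xi2_neq1 => ->; rewrite sqrrN expr1n.
Qed.

Lemma lambda_neq0 : lambda != 0.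
Proof. by rewrite mulf_neq0 ?invr_eq0 ?xi_neq1 ?xi_neqN1. Qed.

Lemma theta_neq0 : theta != 0.
Proof.
rewrite -sqrf_eq0 theta2 mulf_neq0 ?lambda_neq0 // subr_eq0 eq_sym.
by rewrite invr_eq1 xi2_neq1.
Qed.

Lemma xiX2p i : (xi ^+ i) ^+ (2 * p) = 1.
Proof. by rewrite exprAC (prim_expr_order xi_prim) expr1n. Qed.

Lemma signX2p i : ((-1) ^+ i : k) ^+ (2 * p) = 1.
Proof. by rewrite exprAC exprM sqrrN !expr1n. Qed.

Lemma xiXp i : (xi ^+ i) ^+ p = (-1) ^+ i.
Proof. by rewrite exprAC xi_p. Qed.

Lemma chi_rels i : matrix_rels (chi_mx_a i) chi_mx_b (chi_mx_g i) chi_mx_x.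
Proof.
suff h : all (fun x => x == 0)
    (double_rels (chi_mx_a i) chi_mx_b (chi_mx_g i) chi_mx_x).
  by move=> r rS; apply/eqP/(allP h).
rewrite /= /chi_mx_a /chi_mx_b /chi_mx_g /chi_mx_x -!rmorphXn /=.
rewrite !(mul0r, mulr0, expr0n, scaler0, subr0, oppr0, eqxx) /=.
rewrite xiX2p signX2p sqrr_sign.
rewrite -!mulmxE -!scalar_mxM [xi ^+ i * _]mulrC (exprS (xi ^+ i)) xiXp [xi ^+ i * _]mulrC.
by rewrite !(subrr, scaler0, oppr0, addr0, subr0, eqxx).
Qed.

Lemma mx2M a b c d a' b' c' d' : mx2 a b c d * mx2 a' b' c' d' =
  mx2 (a * a' + b * c') (a * b' + b * d') (c * a' + d * c') (c * b' + d * d').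
Proof.
apply/matrixP => r s; rewrite !mxE !big_ord_recl big_ord0 addr0 !mxE /=.
by case: r => [[|[|//]] ?]; case: s => [[|[|//]] ?].
Qed.

Lemma mx2D a b c d a' b' c' d' : mx2 a b c d + mx2 a' b' c' d' =
  mx2 (a + a') (b + b') (c + c') (d + d').
Proof. by apply/matrixP => r s; rewrite !mxE; case: ifP; case: ifP. Qed.

Lemma mx2N a b c d : - mx2 a b c d = mx2 (- a) (- b) (- c) (- d).
Proof. by apply/matrixP => r s; rewrite !mxE; case: ifP; case: ifP. Qed.

Lemma mx2Z l a b c d : l *: mx2 a b c d = mx2 (l * a) (l * b) (l * c) (l * d).
Proof. by apply/matrixP => r s; rewrite !mxE; case: ifP; case: ifP. Qed.

Lemma mx2_1 : 1 = mx2 1 0 0 1.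
Proof.
by apply/matrixP => -[[|[|//]] ?] [[|[|//]] ?]; rewrite !mxE.
Qed.

Lemma mx2X a d m : mx2 a 0 0 d ^+ m = mx2 (a ^+ m) 0 0 (d ^+ m).
Proof.
elim: m => [|m IH]; first by rewrite !expr0 mx2_1.
by rewrite exprS IH mx2M !(mul0r, mulr0, addr0, add0r) -!exprS.
Qed.

Lemma mx2_0 : mx2 0 0 0 0 = 0.
Proof. by apply/matrixP => r s; rewrite !mxE; case: ifP; case: ifP. Qed.

Lemma V_rels i j : matrix_rels (V_mx_a i) V_mx_b (V_mx_g j) (V_mx_x i j).
Proof.
suff h : all (fun x => x == 0)
    (double_rels (V_mx_a i) V_mx_b (V_mx_g j) (V_mx_x i j)).
  by move=> r rS; apply/eqP/(allP h).
rewrite /= /V_mx_a /V_mx_b /V_mx_g /V_mx_x.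
have -> : xi ^ (p%:Z - 1 - i%:Z) = - (xi * xi ^+ i)^-1.
  rewrite !expfzDr ?xi_neq0 // -!invr_expz -!exprnP xi_p expr1.
  by rewrite invfM mulN1r mulNr.
have sgn2 : (-1 : k) ^+ i * (-1) ^+ i = 1 by rewrite -expr2 sqrr_sign.
have e1 : xi ^+ (p + 1 + i) = - xi * xi ^+ i.
  by rewrite !exprD xi_p expr1 mulN1r.
have e2 : xi ^+ p.+1 = - xi by rewrite exprSr xi_p mulN1r.
have e3 : (xi ^+ i) ^+ p.+1 = xi ^+ i * (-1) ^+ i by rewrite exprS xiXp.
have e4 : (xi ^+ i.+1) ^+ p.+1 = - xi ^+ i.+1 * (-1) ^+ i.
  by rewrite (exprS (xi ^+ i.+1)) xiXp [(-1) ^+ _]exprS mulrA mulrN1.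
have e5 : (- xi ^+ j) ^+ (2 * p) = 1.
  by rewrite exprNn xiX2p mulr1 exprM sqrrN !expr1n.
rewrite !mx2X !xiX2p e5 e3 e4 !xiXp e1 e2 exprS.
set s : k := (-1) ^+ i in sgn2 *; set u := xi ^+ i; set w := xi ^+ j.
rewrite !expr2 mx2_1 !(mx2M, mx2N, mx2D, mx2Z).
have un0 : u != 0 by rewrite expf_neq0 ?xi_neq0.
have [xn0 tn0] := (xi_neq0, theta_neq0).
have -> : lambda^-1 * theta = (1 - xi ^- 2) * theta^-1.
  apply: (mulfI lambda_neq0); apply: (mulIf tn0).
  by rewrite mulVKf ?lambda_neq0 // -expr2 theta2 !mulrA mulfVK // -mulrA mulrC.
have ssw : (s + w) * (s - w) = 1 - w * w by rewrite mulrC -subr_sqr !expr2 sgn2.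
have -> : xi ^+ i.+1 = xi * u by rewrite exprS.
have -> : (-1) ^+ i.+1 = - s by rewrite exprS mulN1r.
have f1 : theta^-1 * - (xi * u)^-1 * (s + w) * (theta * (- xi * u) * (s - w)) =
    1 - w * w.
  by rewrite -ssw; field; rewrite xn0 un0 tn0.
have f2 : theta * (- xi * u) * (s - w) * (theta^-1 * - (xi * u)^-1 * (s + w)) =
    1 - w * w by rewrite mulrC f1.
rewrite f1 f2 {f1 f2}.
by do !(apply/andP; split=> //); apply/eqP; rewrite -mx2_0;
  congr (mx2 _ _ _ _); try ring; field; rewrite ?xn0 ?un0 ?tn0.
Qed.

Definition k_chi (i : nat) : lmodType double := matrix_module (@chi_rels i).

Definition V_mod (i j : nat) : lmodType double := matrix_module (@V_rels i j).

Definition simple_list (s : 'I_(2 * p) + Lambda p) : lmodType double :=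
  match s with
  | inl i => k_chi i
  | inr ij => V_mod (val ij).1 (val ij).2
  end.

End Double.

(* Main.v *)
Require Import Defs.
From HB Require Import structures.
From mathcomp Require Import all_boot all_algebra.
From mathcomp.classical Require Import boolp.
From mathcomp.multinomials Require Import monalg.
From mathcomp Require Import ring.

Set Implicit Arguments.
Unset Strict Implicit.
Unset Printing Implicit Defensive.

Import GRing.Theory.
Local Open Scope ring_scope.

(** Simple modules are classified by highest weights, with b as the raising
operator.  As b^2 = 0 and a, g commute with each other and commute with b up to
scalars, every nonzero module contains a nonzero w with b w = 0 which is a joint
eigenvector of a and g, say a w = xi^i w and g w = xi^j w; the eigenvalues are
2p-th roots of unity because a^(2p) = g^(2p) = 1 ([ex_highest_weight]).  As the
module could a priori be infinite-dimensional, the eigenvectors come from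
weighted sums over the powers of a and of g ([ex_eigenvector]).

The relations then determine everything on w and x w ([x_highest_weight]); in
particular b (x w) = c w, with c a nonzero multiple of (-1)^i - xi^j, and
x (x w) = (1 - xi^(2j)) w.
- If (-1)^i is not xi^j, then w and c^-1 x w satisfy the formulas of the basis
  of V_{i,j}, so there is a nonzero homomorphism from V_{i,j} to the module.
- If (-1)^i = xi^j, then x w is killed by b and by x and has weight
  (xi^(i+1), - xi^j).  Whichever of w and x w is the last nonzero one spans a
  copy of a one-dimensional module k_chi.
Since all the listed modules are simple ([simple_list_simple]), Schur's lemma
([schur_bijective]) turns a nonzero homomorphism between simple modules into an
isomorphism.

In each listed module the vectors killed by b form a line, so its weight is an
isomorphism invariant ([killed_highest_weight]).  The exponents of xi in the
weight are (i, p i) for k_chi^i and (i, j) for V_{i,j}, and these exhaust the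
pairs of residues modulo 2p, each once ([weight_index_bij]).  This
bijection shows both that the list has no repetition and that it has
(2p)^2 = 4p^2 members. *)

(** * Simple modules over an arbitrary ring *)

Section Modules.
Variable R : pzRingType.

(** Schur's lemma: the kernel and the image of f are submodules, and f v <> 0
    leaves only one possibility for each. *)
Lemma schur_bijective (M N : lmodType R) (f : {linear M -> N}) (v : M) :
  simple_module M -> simple_module N -> f v != 0 -> bijective f.
Proof.
move=> [_ sM] [_ sN] fv0.
have finj : injective f.
  have kerP : submod_closed [pred u | f u == 0].
    split; first by rewrite inE raddf0.
    by move=> c u w; rewrite !inE linearP => /eqP-> /eqP->; rewrite scaler0 addr0.
  have [ker0|kerT] := sM _ kerP; last by have := kerT v; rewrite inE (negbTE fv0).
  move=> u w /eqP; rewrite -subr_eq0 -raddfB => fuw.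
  by apply/eqP; rewrite -subr_eq0 -ker0 inE.
have imP : submod_closed (fun w => `[< exists u, f u = w >]).
  split; first by apply/asboolP; exists 0; rewrite raddf0.
  move=> c _ _ /asboolP[u <-] /asboolP[w <-].
  by apply/asboolP; exists (c *: u + w); rewrite linearP.
have [im0|imT] := sN _ imP.
  have : f v == 0 by rewrite -im0; apply/asboolP; exists v.
  by rewrite (negbTE fv0).
have fsurj w : exists u, f u = w by apply/asboolP/imT.
have [g gK] := choice fsurj.
by exists g => [u|//]; apply: finj; rewrite gK.
Qed.

Lemma simple_moduleP (M : lmodType R) (v0 : M) : v0 != 0 ->
  (forall (N : {pred M}) v, submod_closed N -> v \in N -> v != 0 ->
     forall w, w \in N) ->
  simple_module M.
Proof.
move=> v00 Nfull; split; first by exists v0.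
move=> N Nsub; have [[v vN v_neq0]|N0] := pselect (exists2 v, v \in N & v != 0).
  by right; apply: Nfull vN v_neq0.
left=> v; apply/idP/eqP => [vN|->]; last by case: Nsub.
by apply/eqP/negPn/negP => v_neq0; apply: N0; exists v.
Qed.

Lemma submodZ (M : lmodType R) (N : {pred M}) c v :
  submod_closed N -> v \in N -> c *: v \in N.
Proof. by case=> N0 NL vN; rewrite -[c *: v]addr0; apply: NL. Qed.

Lemma submodD (M : lmodType R) (N : {pred M}) u v :
  submod_closed N -> u \in N -> v \in N -> u + v \in N.
Proof. by case=> N0 NL uN vN; rewrite -[u]scale1r; apply: NL. Qed.

Lemma module_iso_sym (M N : lmodType R) : module_iso M N -> module_iso N M.
Proof.
case=> f [h fK hK]; pose hM := GRing.isLinear.Build R N M _ h (can2_linear fK hK).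
by exists (HB.pack_for {linear N -> M} h hM), f.
Qed.

End Modules.

(** * Eigenvectors of an operator of finite order *)

Section Eigenvectors.
Variables (k : fieldType) (R : pzRingType) (s : {rmorphism k -> R}).
Hypothesis sC : forall c r, s c * r = r * s c.
Variables (M : lmodType R) (n : nat) (z : k) (d : R).
Hypotheses (z_prim : n.-primitive_root z) (n_neq0 : n%:R != 0 :> k).
Hypothesis dn : d ^+ n = 1.

(** Orthogonality of the characters of the cyclic group of order n: if z^-m is
    not 1, the geometric sum is killed by z^-m - 1. *)
Lemma sum_prim_root_pow m :
  \sum_(i < n) z ^- (i * m) = if (n %| m)%N then n%:R else 0 :> k.
Proof.
have z0 : z != 0 by rewrite (prim_root_eq0 z_prim); apply: contraNneq n_neq0 => ->.
under eq_bigr => i _ do rewrite mulnC exprM -exprVn.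
case: ifP => nm.
  have /eqP-> : z ^+ m == 1 by rewrite -(prim_order_dvd z_prim).
  rewrite invr1 (eq_bigr (fun _ => 1)) => [|i _]; last by rewrite expr1n.
  by rewrite sumr_const card_ord.
have zm : z ^- m - 1 != 0.
  by rewrite subr_eq0 invr_eq1 -(prim_order_dvd z_prim) nm.
apply: (mulfI zm); rewrite mulr0 -subrX1 -exprVn exprAC exprVn.
by rewrite (prim_expr_order z_prim) invr1 expr1n subrr.
Qed.

(** The sum w_i of the z^-(im) d^m v over m < n is zero or an eigenvector of d,
    and the w_i sum to n v by orthogonality, so they cannot all vanish.  The
    predicate K stands for a subspace stable under d: applying the lemma with K
    an eigenspace of a commuting operator gives a joint eigenvector. *)
Lemma ex_eigenvector (K : M -> Prop) (v : M) :
  (forall u w, K u -> K w -> K (u + w)) ->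
  (forall c u, K u -> K (s c *: u)) -> (forall u, K u -> K (d *: u)) ->
  K v -> v != 0 ->
  exists i : 'I_n, exists w : M, [/\ K w, w != 0 & d *: w = s (z ^+ i) *: w].
Proof.
move=> KD KZ Kd Kv v0.
have z0 : z != 0 by rewrite (prim_root_eq0 z_prim); apply: contraNneq n_neq0 => ->.
have n_gt0 : (0 < n)%N by rewrite lt0n; apply: contraNneq n_neq0 => ->.
pose w (i : 'I_n) := \sum_(m < n) s (z ^- (i * m)) *: (d ^+ m *: v).
have Kw i : K (w i).
  apply: big_ind => [|//|m _].
    by have := KZ 0 _ Kv; rewrite rmorph0 scale0r.
  apply: KZ; elim: (m : nat) => [|l IH]; first by rewrite expr0 scale1r.
  by rewrite exprS -scalerA; apply: Kd.
have dw i : d *: w i = s (z ^+ i) *: w i.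
  rewrite /w scaler_sumr.
  have E m : d *: (s (z ^- (i * m)) *: (d ^+ m *: v)) =
      s (z ^+ i) *: (s (z ^- (i * m.+1)) *: (d ^+ m.+1 *: v)).
    rewrite !scalerA -sC -mulrA -exprS -rmorphM; congr (s _ * _ *: v).
    by rewrite mulnS exprD invfM mulVKf ?expf_neq0.
  under eq_bigr => m _ do rewrite E.
  rewrite -scaler_sumr; congr (_ *: _).
  (* d shifts the summands cyclically, since F n = F 0. *)
  pose F m := s (z ^- (i * m)) *: (d ^+ m *: v).
  rewrite -[LHS]/(\sum_(m < n) F m.+1) -[RHS]/(\sum_(m < n) F m).
  apply/subr0_eq; rewrite -sumrB -(big_mkord predT (fun m => F m.+1 - F m)).
  rewrite telescope_sumr // /F dn mulnC exprM (prim_expr_order z_prim) expr1n.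
  by rewrite muln0 !expr0 subrr.
have sumw : \sum_i w i = s n%:R *: v.
  rewrite exchange_big /=.
  under eq_bigr => m _ do rewrite -scaler_suml -rmorph_sum sum_prim_root_pow.
  rewrite (bigD1 (Ordinal n_gt0)) //= dvdn0 expr0 scale1r //.
  rewrite big1 ?addr0 // => m m0.
  rewrite gtnNdvd ?ltn_ord // ?rmorph0 ?scale0r // lt0n.
  by apply: contraNneq m0 => m0; apply/eqP/val_inj.
have [i wi|w0] := pickP (fun i => w i != 0); first by exists i, (w i).
case/eqP: v0; rewrite -[v]scale1r -(rmorph1 s) -(mulVf n_neq0) rmorphM -scalerA.
by rewrite -sumw big1 ?scaler0 // => i _; apply/eqP/negbFE/w0.
Qed.

End Eigenvectors.

(** * Generators and relations of the double *)

Section Relations.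
Variables (k : fieldType) (p : nat) (xi theta : k).

(** The defining relations in a ring T without a k-algebra structure: s plays the
    structure map from k to the centre of T.  The double itself is such a
    ring, and so the computations with highest weights below can be carried out
    for an arbitrary T instead of the quotient of a free algebra. *)
Record satisfies_double_rels (T : pzRingType) (s : k -> T) (a b g x : T) : Prop :=
  DoubleRels {
    rel_a : a ^+ (2 * p) = 1;
    rel_b : b ^+ 2 = 0;
    rel_ba : b * a = s xi * (a * b);
    rel_g : g ^+ (2 * p) = 1;
    rel_x : x ^+ 2 = 1 - g ^+ 2;
    rel_gx : g * x = - (x * g);
    rel_ag : a * g = g * a;
    rel_bg : b * g = - (g * b);
    rel_ax : a * x = s xi * (x * a)
      + s ((lambda xi)^-1 * theta * xi ^+ p.+1) * (b * a ^+ p - g * b);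
    rel_bx : b * x = s xi * (x * b)
      + s (theta * xi ^+ p.+1) * (a ^+ p.+1 - g * a)
  }.

Lemma satisfies_double_rels_image (A : lalgType k) (T : pzRingType)
    (f : {rmorphism A -> T}) (s : k -> T) (fZ : forall c u, f (c *: u) = s c * f u)
    (a b g x : A) :
  (forall r, r \in double_rels p xi theta a b g x -> f r = 0) ->
  satisfies_double_rels s (f a) (f b) (f g) (f x).
Proof.
move=> f0.
have /allP : {in double_rels p xi theta a b g x, forall r, f r == 0}.
  by move=> r /f0->.
rewrite /= !(rmorphB, rmorphN, fZ, rmorphM, rmorphXn, rmorph1) /= !subr_eq0 andbT.
do 9!(case/andP=> /eqP ?); move/eqP=> ?; split=> //.
- by apply/eqP; rewrite addrC -subr_eq; apply/eqP.
- by apply/eqP; rewrite addrC -subr_eq; apply/eqP.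
Qed.

End Relations.

Section Double.
Variables (k : fieldType) (p : nat) (xi theta : k).
Local Notation D := (Defs.double p xi theta).
Local Notation sc := (double_scalar p xi theta).
Local Notation pi := (double_pi p xi theta).
Local Notation a := (da p xi theta).
Local Notation b := (db p xi theta).
Local Notation g := (dg p xi theta).
Local Notation x := (dx p xi theta).

(** Expand an element on the basis of words; a word is a product of
    generators. *)
Lemma free_ind n (P : free_algebra k n -> Prop) :
  (forall c, P (free_scalar n c)) -> (forall i, P (free_gen k i)) ->
  (forall u v, P u -> P v -> P (u + v)) ->
  (forall u v, P u -> P v -> P (u * v)) -> forall u, P u.
Proof.
move=> Pc Pg PD PM u; rewrite [u]monalgE.
apply: big_ind => [||w _] //; first by have := Pc 0; rewrite /free_scalar scale0r.
have -> : << u@_w *g w >> = free_scalar n u@_w * << w >>.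
  rewrite /free_scalar -scalerAl mul1r; apply/malgP => w'.
  by rewrite mcoeffZ !mcoeffU mulrnAr mulr1.
apply: (PM) => //; case: w => l; elim: l => [|i l IH].
  by have := Pc 1; rewrite /free_scalar scale1r -fmoneE.
have -> : << FMonom (i :: l) >> = free_gen k i * << FMonom l >>.
  rewrite /free_gen [RHS]fgmulUU mulr1; congr (<< _ >>).
  by apply/val_inj; rewrite /= fmM fmU.
exact: PM.
Qed.

Lemma double_ind (P : D -> Prop) :
  (forall c, P (sc c)) -> (forall i, P (pi (free_gen k i))) ->
  (forall u v, P u -> P v -> P (u + v)) ->
  (forall u v, P u -> P v -> P (u * v)) -> forall d, P d.
Proof.
move=> Pc Pg PD PM; elim/rq_ind=> f; rewrite -/(pi f).
elim/free_ind: f => [//|//|u v Pu Pv|u v Pu Pv]; rewrite ?rmorphD ?rmorphM.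
  exact: PD.
exact: PM.
Qed.

Lemma double_piZ c f : pi (c *: f) = sc c * pi f.
Proof. by rewrite /double_scalar -rmorphM /free_scalar -scalerAl mul1r. Qed.

Lemma double_relations : satisfies_double_rels p xi theta sc a b g x.
Proof.
apply: (satisfies_double_rels_image double_piZ) => r rI.
by rewrite -(rmorph0 pi); apply/rq_piP; rewrite subr0; apply: tsi_gen.
Qed.

End Double.

(** * Homomorphisms out of a module given by matrices *)

Section ScalarAction.
Variables (k : fieldType) (R : pzRingType) (s : {rmorphism k -> R}).
Hypothesis sC : forall c r, s c * r = r * s c.
Variable M : lmodType R.

Lemma scalar_actK c (v : M) : c != 0 -> s c^-1 *: (s c *: v) = v.
Proof. by move=> c0; rewrite scalerA -rmorphM mulVf // rmorph1 scale1r. Qed.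

Lemma scalar_act_inj c d (v : M) : v != 0 -> s c *: v = s d *: v -> c = d.
Proof.
move=> v0 cdv; apply/eqP; rewrite -subr_eq0; apply: contraNT v0 => cd0.
by rewrite -(scalar_actK v cd0) rmorphB scalerBl cdv subrr scaler0.
Qed.

Variables (n : nat) (rho : {rmorphism R -> 'M[k]_n.+1}) (e : 'I_n.+1 -> M).
Hypothesis rho_s : forall c, rho (s c) = c%:M.

(** If this holds for all d, the span of the e j in M is the image of the
    representation rho under the map sending the standard basis to e. *)
Definition acts_by_rho d := forall j, d *: e j = \sum_r s (rho d r j) *: e r.

Lemma acts_by_rho_scalar c : acts_by_rho (s c).
Proof.
move=> j; rewrite (bigD1 j) //= big1 ?addr0 => [|r rj]; rewrite rho_s !mxE.
  by rewrite eqxx mulr1n.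
by rewrite (negbTE rj) mulr0n rmorph0 scale0r.
Qed.

Lemma acts_by_rhoD d d' :
  acts_by_rho d -> acts_by_rho d' -> acts_by_rho (d + d').
Proof.
move=> hd hd' j; rewrite scalerDl hd hd' -big_split /=; apply: eq_bigr => r _.
by rewrite rmorphD mxE rmorphD scalerDl.
Qed.

Lemma acts_by_rhoM d d' :
  acts_by_rho d -> acts_by_rho d' -> acts_by_rho (d * d').
Proof.
move=> hd hd' j; rewrite -scalerA hd' scaler_sumr.
under eq_bigr => r _ do rewrite scalerA -sC -scalerA hd scaler_sumr.
rewrite exchange_big /=; apply: eq_bigr => t _.
rewrite rmorphM mxE rmorph_sum scaler_suml; apply: eq_bigr => r _.
by rewrite scalerA -rmorphM mulrC.
Qed.

Definition basis_map (v : 'cV[k]_n.+1) : M := \sum_r s (v r 0) *: e r.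

Lemma basis_mapD u v : basis_map (u + v) = basis_map u + basis_map v.
Proof.
rewrite -big_split; apply: eq_bigr => r _.
by rewrite mxE rmorphD scalerDl.
Qed.

Lemma basis_map_delta j : basis_map (delta_mx j 0) = e j.
Proof.
rewrite /basis_map (bigD1 j) //= big1 ?addr0 => [|r rj]; rewrite !mxE.
  by rewrite !eqxx rmorph1 scale1r.
by rewrite (negbTE rj) rmorph0 scale0r.
Qed.

Lemma basis_map_equivariant d v :
  acts_by_rho d -> basis_map (rho d *m v) = d *: basis_map v.
Proof.
move=> hd; rewrite scaler_sumr.
under [RHS]eq_bigr => j _ do rewrite scalerA -sC -scalerA hd scaler_sumr.
rewrite exchange_big /=; apply: eq_bigr => t _.
rewrite mxE rmorph_sum scaler_suml; apply: eq_bigr => r _.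
by rewrite scalerA -rmorphM mulrC.
Qed.

End ScalarAction.

Section Hom.
Variables (k : fieldType) (p : nat) (xi theta : k).
Local Notation D := (Defs.double p xi theta).
Local Notation sc := (double_scalar p xi theta).
Local Notation pi := (double_pi p xi theta).

Variables (n : nat) (A B G X : 'M[k]_n.+1) (h : matrix_rels p xi theta A B G X).

Lemma double_eval_scalar c : double_eval h (sc c) = c%:M.
Proof. by rewrite /double_eval rq_liftE /= free_evalZ rmorph1 scalemx1. Qed.

Definition basis_vec j : matrix_module h := (delta_mx j 0 : 'cV[k]_n.+1).

Lemma matrix_module_decomp (v : matrix_module h) :
  v = \sum_r sc ((v : 'cV[k]_n.+1) r 0) *: basis_vec r.
Proof.
under eq_bigr => r _ do rewrite matrix_module_scalarE.
apply: etrans (matrix_sum_delta (v : 'cV[k]_n.+1)) _; apply: eq_bigr => r _.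
exact: big_ord1.
Qed.

(** Homomorphisms out of a matrix module are the families of vectors on which
    the four generators act by the given matrices: the elements of the double
    acting by their matrices form a subalgebra ([acts_by_rhoD],
    [acts_by_rhoM]), which is everything once it contains the generators. *)
Lemma matrix_module_hom (M : lmodType D) (e : 'I_n.+1 -> M) :
    (forall j, da p xi theta *: e j = \sum_r sc (A r j) *: e r) ->
    (forall j, db p xi theta *: e j = \sum_r sc (B r j) *: e r) ->
    (forall j, dg p xi theta *: e j = \sum_r sc (G r j) *: e r) ->
    (forall j, dx p xi theta *: e j = \sum_r sc (X r j) *: e r) ->
  exists f : {linear matrix_module h -> M},
    forall j, f (basis_vec j) = e j.
Proof.
move=> ha hb hg hx.
have he i j : pi (free_gen k i) *: e j
    = \sum_r sc (gen_images A B G X i r j) *: e r.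
  case: i => [[|[|[|[|i]]]] lti]; last by discriminate lti.
  - by rewrite (_ : Ordinal lti = gen_a); [exact: ha | exact: val_inj].
  - by rewrite (_ : Ordinal lti = gen_b); [exact: hb | exact: val_inj].
  - by rewrite (_ : Ordinal lti = gen_g); [exact: hg | exact: val_inj].
  - by rewrite (_ : Ordinal lti = gen_x); [exact: hx | exact: val_inj].
have hd d : acts_by_rho sc (double_eval h) e d.
  elim/double_ind: d => [c|i|u v|u v].
  - exact: (acts_by_rho_scalar _ double_eval_scalar).
  - by move=> j; rewrite he; apply: eq_bigr => r _; rewrite -(double_eval_gen h).
  - exact: acts_by_rhoD.
  - exact: (acts_by_rhoM (@double_scalarC _ _ _ _)).
pose f (v : matrix_module h) : M := basis_map sc e v.
have fL : linear f.
  move=> d u v; rewrite /f (basis_mapD sc e (_ : 'cV_n.+1)); congr (_ + _).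
  exact: (basis_map_equivariant (@double_scalarC _ _ _ _) u (hd d)).
pose fM := GRing.isLinear.Build D (matrix_module h) M _ f fL.
exists (HB.pack_for {linear matrix_module h -> M} f fM) => j.
exact: basis_map_delta.
Qed.

End Hom.

(** * Highest weight vectors *)

Section HighestWeight.
Variables (k : fieldType) (p : nat) (xi theta : k).
Hypotheses (p_ge2 : (2 <= p)%N) (xi_prim : (2 * p).-primitive_root xi).
Variables (R : pzRingType) (s : {rmorphism k -> R}) (a b g x : R).
Hypothesis sC : forall c r, s c * r = r * s c.
Hypothesis rels : satisfies_double_rels p xi theta s a b g x.
Variable M : lmodType R.

Definition highest_weight (al be : k) (w : M) :=
  [/\ b *: w = 0, a *: w = s al *: w & g *: w = s be *: w].

Lemma highest_weight_uniq al be al' be' (w : M) : w != 0 ->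
  highest_weight al be w -> highest_weight al' be' w -> al = al' /\ be = be'.
Proof.
move=> w0 [_ aw gw] [_ aw' gw'].
by split; apply: (scalar_act_inj (s := s) w0); rewrite -?aw -?gw.
Qed.

Lemma scalarCA c r (v : M) : r *: (s c *: v) = s c *: (r *: v).
Proof. by rewrite !scalerA sC. Qed.

Lemma highest_weightZ al be c w :
  highest_weight al be w -> highest_weight al be (s c *: w).
Proof.
case=> bw aw gw; split.
- by rewrite (scalarCA _ b) bw scaler0.
- by rewrite (scalarCA _ a) aw (scalarCA c).
- by rewrite (scalarCA _ g) gw (scalarCA c).
Qed.

Lemma eigen_expr d c m (w : M) : d *: w = s c *: w -> d ^+ m *: w = s (c ^+ m) *: w.
Proof.
move=> dw; elim: m => [|m IH]; first by rewrite !expr0 rmorph1.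
by rewrite exprS -scalerA IH scalarCA dw scalerA -rmorphM -exprSr.
Qed.

(** The commutation relations move x to the left of a, b and g, whose action on
    w is known.  In the formula for a, the correction term b a^p - g b vanishes
    on w; in the formula for b, the term a^(p+1) - g a produces
    xi^i ((-1)^i - xi^j), because (xi^i)^p = (-1)^i. *)
Lemma x_highest_weight i j w : highest_weight (xi ^+ i) (xi ^+ j) w ->
  [/\ a *: (x *: w) = s (xi ^+ i.+1) *: (x *: w),
      b *: (x *: w)
        = s (theta * xi ^+ (p + 1 + i) * ((-1) ^+ i - xi ^+ j)) *: w,
      g *: (x *: w) = s (- xi ^+ j) *: (x *: w)
    & x *: (x *: w) = s (1 - xi ^+ j ^+ 2) *: w].
Proof.
case=> bw aw gw; split.
- rewrite scalerA (rel_ax rels) scalerDl -!scalerA scalerBl -!scalerA.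
  rewrite (eigen_expr _ aw) (scalarCA _ b) bw !scaler0 subrr scaler0 addr0.
  by rewrite aw (scalarCA _ x) scalerA -rmorphM exprS.
- rewrite scalerA (rel_bx rels) scalerDl -!scalerA scalerBl -!scalerA.
  rewrite bw !scaler0 add0r aw scalarCA gw (eigen_expr _ aw) scalerA -rmorphM.
  rewrite -scalerBl -rmorphB scalerA -rmorphM; congr (s _ *: _).
  rewrite (exprS (xi ^+ i)) (xiXp p_ge2 xi_prim) -mulrBr mulrA; congr (_ * _).
  by rewrite -mulrA -exprD addn1.
- by rewrite scalerA (rel_gx rels) scaleNr -scalerA gw scalarCA rmorphN scaleNr.
- rewrite scalerA -expr2 (rel_x rels) scalerBl scale1r (eigen_expr _ gw).
  by rewrite rmorphB rmorph1 scalerBl scale1r.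
Qed.

(** The vector u = c^-1 x w completes w to a pair on which the generators act as
    on the basis of V_{i,j}.  The scalar c', the upper right entry of the
    matrix of x, is forced by x^2 = 1 - g^2. *)
Lemma ex_b_preimage i j w c' :
  let c := theta * xi ^+ (p + 1 + i) * ((-1) ^+ i - xi ^+ j) in
  highest_weight (xi ^+ i) (xi ^+ j) w -> c != 0 -> c * c' = 1 - xi ^+ j ^+ 2 ->
  exists u : M, [/\ a *: u = s (xi ^+ i.+1) *: u, b *: u = w,
    g *: u = s (- xi ^+ j) *: u, x *: w = s c *: u & x *: u = s c' *: w].
Proof.
move=> c /x_highest_weight[axw bxw gxw xxw] c0 cc'.
exists (s c^-1 *: (x *: w)); split.
- by rewrite (scalarCA _ a) axw (scalarCA c^-1).
- by rewrite (scalarCA _ b) bxw scalar_actK.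
- by rewrite (scalarCA _ g) gxw (scalarCA c^-1).
- by rewrite scalerA -rmorphM divff // rmorph1 scale1r.
- rewrite (scalarCA _ x) xxw scalerA -rmorphM; congr (s _ *: _).
  by apply: (mulfI c0); rewrite cc' mulVKf.
Qed.

(** One of v and b v is killed by b.  The kernel of b is stable under a, and the
    a-eigenspaces in it are stable under g, so [ex_eigenvector] applies twice. *)
Lemma ex_highest_weight (v : M) : (2 * p)%:R != 0 :> k -> v != 0 ->
  exists i j : 'I_(2 * p), exists2 w : M,
    w != 0 & highest_weight (xi ^+ i) (xi ^+ j) w.
Proof.
move=> p0 v0.
have [u u0 bu] : exists2 u : M, u != 0 & b *: u = 0.
  have [bv|bv] := eqVneq (b *: v) 0; first by exists v.
  by exists (b *: v); rewrite // scalerA -expr2 (rel_b rels) scale0r.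
have := ex_eigenvector sC xi_prim p0 (rel_a rels) (K := fun w : M => b *: w = 0)
  (v := u).
case=> [w w'|c w|w||//|i [w [bw w0 aw]]].
- by move=> bw bw'; rewrite scalerDr bw bw' addr0.
- by move=> bw; rewrite scalarCA bw scaler0.
- by move=> bw; rewrite scalerA (rel_ba rels) -!scalerA bw !scaler0.
- exact: bu.
have := ex_eigenvector sC xi_prim p0 (rel_g rels)
  (K := fun w : M => b *: w = 0 /\ a *: w = s (xi ^+ i) *: w) (v := w).
case=> [w1 w2|c w1|w1||//|j [z [[bz az] z0 gz]]].
- by move=> [b1 a1] [b2 a2]; rewrite !scalerDr b1 b2 a1 a2 addr0.
- move=> [b1 a1]; rewrite (scalarCA _ b) b1 scaler0.
  by rewrite (scalarCA _ a) a1 (scalarCA c).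
- move=> [b1 a1]; rewrite !scalerA (rel_bg rels) (rel_ag rels).
  by rewrite scaleNr -!scalerA b1 a1 scaler0 oppr0 (scalarCA _ g).
- by [].
by exists i, j, z.
Qed.

End HighestWeight.

Lemma highest_weight_hom (k : fieldType) (R : pzRingType)
    (s : {rmorphism k -> R}) (a b g : R) (M N : lmodType R)
    (f : {linear M -> N}) al be (w : M) :
  highest_weight s a b g al be w -> highest_weight s a b g al be (f w).
Proof.
have fZ d v : f (d *: v) = d *: f v by apply: linearZ.
case=> bw aw gw; split; first by rewrite -fZ bw raddf0.
  by rewrite -fZ aw fZ.
by rewrite -fZ gw fZ.
Qed.

(** * The listed modules *)

Section SimpleModules.
Variables (k : fieldType) (p : nat) (xi theta : k).
Hypotheses (p_ge2 : (2 <= p)%N) (xi_prim : (2 * p).-primitive_root xi).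
Hypothesis (theta2 : theta ^+ 2 = (1 - xi ^- 2) * lambda xi).
Local Notation D := (Defs.double p xi theta).
Local Notation sc := (double_scalar p xi theta).
Local Notation a := (da p xi theta).
Local Notation b := (db p xi theta).
Local Notation g := (dg p xi theta).
Local Notation x := (dx p xi theta).
Local Notation V := (V_mod p_ge2 xi_prim theta2).
Local Notation K := (k_chi theta p_ge2 xi_prim).

Definition Vb i j r : V i j := basis_vec _ r.

Lemma matrix_module_decomp2 (A B G X : 'M[k]_2)
    (h : matrix_rels p xi theta A B G X) (v : matrix_module h) :
  v = sc ((v : 'cV[k]_2) 0 0) *: basis_vec h 0
    + sc ((v : 'cV[k]_2) 1 0) *: basis_vec h 1.
Proof.
rewrite [LHS](matrix_module_decomp v) !big_ord_recl big_ord0 addr0.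
by rewrite (_ : lift ord0 ord0 = 1) //; apply: val_inj.
Qed.

Lemma matrix_module_hom2 (A B G X : 'M[k]_2)
    (h : matrix_rels p xi theta A B G X) (M : lmodType D) (w u : M) :
  let act (d : D) (C : 'M[k]_2) :=
    d *: w = sc (C 0 0) *: w + sc (C 1 0) *: u
    /\ d *: u = sc (C 0 1) *: w + sc (C 1 1) *: u in
  act a A -> act b B -> act g G -> act x X ->
  exists f : {linear matrix_module h -> M}, f (basis_vec h 0) = w.
Proof.
move=> act aA bB gG xX; pose e (r : 'I_2) := if r == 0 then w else u.
have eE d C : act d C -> forall j, d *: e j = \sum_r sc (C r j) *: e r.
  move=> [dw du] j; rewrite !big_ord_recl big_ord0 addr0 /e /=.
  rewrite (_ : lift ord0 ord0 = 1); last exact: val_inj.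
  have [->|->] : j = 0 \/ j = 1 by
    case: j => [[|[|//]] ltj]; [left | right]; apply: val_inj.
  - exact: dw.
  - exact: du.
have [f fe] :=
  matrix_module_hom h (eE _ _ aA) (eE _ _ bB) (eE _ _ gG) (eE _ _ xX).
by exists f; rewrite fe.
Qed.

Lemma V_decomp i j (v : V i j) :
  v = sc ((v : 'cV[k]_2) 0 0) *: Vb i j 0 + sc ((v : 'cV[k]_2) 1 0) *: Vb i j 1.
Proof. exact: matrix_module_decomp2. Qed.

Lemma V_a i j : a *: Vb i j 0 = sc (xi ^+ i) *: Vb i j 0.
Proof.
rewrite matrix_module_aE matrix_module_scalarE -colE.
by apply/colP => -[[|[|//]] lti]; rewrite !mxE /= ?mulr1 ?mulr0.
Qed.

Lemma V_g i j : g *: Vb i j 0 = sc (xi ^+ j) *: Vb i j 0.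
Proof.
rewrite matrix_module_gE matrix_module_scalarE -colE.
by apply/colP => -[[|[|//]] lti]; rewrite !mxE /= ?mulr1 ?mulr0.
Qed.

Lemma V_b i j (v : V i j) : b *: v = sc ((v : 'cV[k]_2) 1 0) *: Vb i j 0.
Proof.
rewrite matrix_module_bE matrix_module_scalarE.
apply/colP => -[[|[|//]] lti]; rewrite !mxE /= !big_ord_recl big_ord0 !mxE /=;
rewrite ?(mulr1, mul1r, mul0r, mulr0, add0r, addr0) //.
by congr (v _ _); apply: val_inj.
Qed.

Lemma V_x i j : x *: Vb i j 0 =
  sc (theta * xi ^+ (p + 1 + i) * ((-1) ^+ i - xi ^+ j)) *: Vb i j 1.
Proof.
rewrite matrix_module_xE matrix_module_scalarE -colE.
by apply/colP => -[[|[|//]] lti]; rewrite !mxE /= ?mulr1 ?mulr0.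
Qed.

Lemma Vb_neq0 i j : Vb i j 0 != 0.
Proof.
apply/eqP => /(congr1 (fun v : V i j => (v : 'cV[k]_2) 0 0)) /eqP.
by rewrite !mxE /= oner_eq0.
Qed.

Lemma V_hom i j (M : lmodType D) (w u : M) :
  a *: w = sc (xi ^+ i) *: w -> a *: u = sc (xi ^+ i.+1) *: u ->
  b *: w = 0 -> b *: u = w ->
  g *: w = sc (xi ^+ j) *: w -> g *: u = sc (- xi ^+ j) *: u ->
  x *: w = sc (theta * xi ^+ (p + 1 + i) * ((-1) ^+ i - xi ^+ j)) *: u ->
  x *: u = sc (theta^-1 * xi ^ (p%:Z - 1 - i%:Z) * ((-1) ^+ i + xi ^+ j)) *: w ->
  exists f : {linear V i j -> M}, f (Vb i j 0) = w.
Proof.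
move=> aw au bw bu gw gu xw xu.
have sc0 : sc 0 = 0 by apply: rmorph0.
have sc1 : sc 1 = 1 by apply: rmorph1.
have h2 := matrix_module_hom2 (@V_rels _ _ _ _ p_ge2 xi_prim theta2 i j).
apply: (h2 M w u).
all: split; rewrite !mxE /= ?sc0 ?sc1 ?scale0r ?addr0 ?add0r.
- exact: aw.
- exact: au.
- exact: bw.
- by rewrite scale1r; exact: bu.
- exact: gw.
- exact: gu.
- exact: xw.
- exact: xu.
Qed.

Definition Kb i : K i := basis_vec _ 0.

Lemma K_decomp i (v : K i) : v = sc ((v : 'cV[k]_1) 0 0) *: Kb i.
Proof. by rewrite [LHS](matrix_module_decomp v) big_ord1. Qed.

Lemma K_a i (v : K i) : a *: v = sc (xi ^+ i) *: v.
Proof. by rewrite matrix_module_aE matrix_module_scalarE mul_scalar_mx. Qed.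

Lemma K_g i (v : K i) : g *: v = sc ((-1) ^+ i) *: v.
Proof. by rewrite matrix_module_gE matrix_module_scalarE mul_scalar_mx. Qed.

Lemma K_b i (v : K i) : b *: v = 0.
Proof. by rewrite matrix_module_bE mul0mx. Qed.

Lemma K_hom i (M : lmodType D) (w : M) :
  a *: w = sc (xi ^+ i) *: w -> b *: w = 0 ->
  g *: w = sc ((-1) ^+ i) *: w -> x *: w = 0 ->
  exists f : {linear K i -> M}, f (Kb i) = w.
Proof.
move=> aw bw gw xw.
pose h1 := @chi_rels _ _ _ theta p_ge2 xi_prim i.
have [] := @matrix_module_hom _ _ _ _ _ _ _ _ _ h1 M (fun _ => w).
5: by move=> f fe; exists f; rewrite fe.
all: by move=> r; rewrite big_ord1 !mxE ?ord1 ?eqxx ?mulr1n ?rmorph0 ?scale0r.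
Qed.

Lemma Kb_neq0 i : Kb i != 0.
Proof.
apply/eqP => /(congr1 (fun v : K i => (v : 'cV[k]_1) 0 0)) /eqP.
by rewrite !mxE /= oner_eq0.
Qed.

Lemma K_simple i : simple_module (K i).
Proof.
apply: (simple_moduleP (Kb_neq0 i)) => N v Nsub vN v0 w.
rewrite (K_decomp w); apply: submodZ => //.
move: vN v0; rewrite (K_decomp v); set c := _ 0 0 => vN v0.
have c0 : c != 0 by apply: contraNneq v0 => ->; rewrite rmorph0 scale0r.
by rewrite -(scalar_actK (double_scalar _ _ _) (Kb i) c0); apply: submodZ.
Qed.

(** A nonzero submodule contains a nonzero multiple of the first basis vector:
    take v itself or b v.  Applying x then gives the second basis vector, as the
    lower left entry of the matrix of x is nonzero. *)
Lemma V_simple i j : (-1) ^+ i != xi ^+ j -> simple_module (V i j).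
Proof.
move=> ij; apply: (simple_moduleP (Vb_neq0 i j)) => N v Nsub vN v0 w.
have e0N c : c != 0 -> sc c *: Vb i j 0 \in N -> Vb i j 0 \in N.
  move=> c0 cN; rewrite -(scalar_actK (double_scalar _ _ _) (Vb i j 0) c0).
  exact: submodZ.
have {}e0N : Vb i j 0 \in N.
  have [v1|v1] := eqVneq ((v : 'cV[k]_2) 1 0) 0.
    move: vN v0; rewrite (V_decomp v) v1 rmorph0 scale0r addr0.
    set c := _ 0 0 => vN v0; apply: (e0N c) => //.
    by apply: contraNneq v0 => ->; rewrite rmorph0 scale0r.
  by apply: e0N v1 _; rewrite -V_b; apply: submodZ.
rewrite (V_decomp w); apply: submodD => //; apply: submodZ => //.
have c0 : theta * xi ^+ (p + 1 + i) * ((-1) ^+ i - xi ^+ j) != 0.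
  have [xi0 t0] := (xi_neq0 p_ge2 xi_prim, theta_neq0 p_ge2 xi_prim theta2).
  by rewrite !mulf_neq0 ?expf_neq0 ?subr_eq0.
have <- : sc (theta * xi ^+ (p + 1 + i) * ((-1) ^+ i - xi ^+ j))^-1
    *: (x *: Vb i j 0) = Vb i j 1.
  exact: etrans (congr1 _ (V_x i j)) (scalar_actK _ _ c0).
exact: (submodZ _ Nsub (submodZ _ Nsub e0N)).
Qed.

(** The exponents of the weight of each listed module.  For k_chi^i the
    eigenvalue (-1)^i of g is xi^(pi). *)
Definition weight_index (t : 'I_(2 * p) + Lambda p) : 'I_(2 * p) * 'I_(2 * p) :=
  match t with
  | inl i => (i, Ordinal (ltn_pmod (p * i) (leq_ltn_trans (leq0n i) (ltn_ord i))))
  | inr ij => val ij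
  end.

(** The pairs excluded from Lambda are the (i, j) with j = pi modulo 2p, which
    are the weights of the one-dimensional modules. *)
Lemma weight_index_bij : bijective weight_index.
Proof.
pose back (ij : 'I_(2 * p) * 'I_(2 * p)) : 'I_(2 * p) + Lambda p :=
  if insub ij is Some l then inr l else inl ij.1.
exists back => [[i|l]|[i j]]; rewrite /back.
- by rewrite insubN //= modn_mod eqxx.
- by rewrite valK.
- case: insubP => [l _ //|/=]; rewrite negbK => /eqP e.
  by congr (_, _); apply: val_inj; rewrite /= e modn_small.
Qed.

Lemma sign_xiX i : (-1) ^+ i = xi ^+ (p * i).
Proof. by rewrite exprM (xi_p p_ge2 xi_prim). Qed.

Local Notation S := (simple_list p_ge2 xi_prim theta2).

Lemma LambdaP (l : Lambda p) : (-1) ^+ (val l).1 != xi ^+ (val l).2.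
Proof. by rewrite sign_xiX (eq_prim_root_expr xi_prim) (valP l). Qed.

Lemma simple_list_simple t : simple_module (S t).
Proof. by case: t => [i|l]; [exact: K_simple | exact/V_simple/LambdaP]. Qed.

Lemma killed_highest_weight t (w : S t) : b *: w = 0 ->
  highest_weight sc a b g (xi ^+ (weight_index t).1) (xi ^+ (weight_index t).2) w.
Proof.
case: t w => [i|l] w bw /=.
  split=> //; first exact: K_a.
  by rewrite (prim_expr_mod xi_prim) -sign_xiX; exact: K_g.
have hw0 : highest_weight sc a b g (xi ^+ (val l).1) (xi ^+ (val l).2)
    (Vb (val l).1 (val l).2 0).
  split; [by rewrite V_b !mxE rmorph0 scale0r | exact: V_a | exact: V_g].
have sc0 : sc 0 *: Vb (val l).1 (val l).2 0 = 0 by rewrite rmorph0 scale0r.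
have w1 : (w : 'cV[k]_2) 1 0 = 0.
  apply: (scalar_act_inj (s := sc) (Vb_neq0 (val l).1 (val l).2)).
  exact: etrans (esym (V_b w)) (etrans bw (esym sc0)).
rewrite (V_decomp w) w1 rmorph0 scale0r addr0.
exact: (highest_weightZ (s := sc) (@double_scalarC _ _ _ _) _ hw0).
Qed.

Lemma ex_killed_vector t : exists2 w : S t, w != 0 & b *: w = 0.
Proof.
case: t => [i|l]; first by exists (Kb i); [exact: Kb_neq0 | exact: K_b].
exists (Vb (val l).1 (val l).2 0); first exact: Vb_neq0.
by rewrite V_b !mxE rmorph0 scale0r.
Qed.

(** An isomorphism carries a vector killed by b to another one of the same
    weight, and the weight determines the index. *)
Lemma simple_list_inj t u : module_iso (S t) (S u) -> t = u.
Proof.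
case=> f fbij; have [w w0 bw] := ex_killed_vector t.
have fw0 : f w != 0 by rewrite -(raddf0 f) (inj_eq (bij_inj fbij)).
have hw := highest_weight_hom f (killed_highest_weight bw).
have [bfw _ _] := hw; have hw' := killed_highest_weight bfw.
have [al be] := highest_weight_uniq fw0 hw hw'.
have xi_inj (i j : 'I_(2 * p)) : xi ^+ i = xi ^+ j -> i = j.
  move/eqP; rewrite (eq_prim_root_expr xi_prim) !modn_small // => /eqP.
  exact: val_inj.
by apply: (bij_inj weight_index_bij); apply: injective_projections; apply: xi_inj.
Qed.

(** * The classification *)

Lemma iso_of_hom t (M : lmodType D) (f : {linear S t -> M}) v :
  simple_module M -> f v != 0 -> module_iso M (S t).
Proof.
move=> sM fv; apply: module_iso_sym; exists f.
exact: schur_bijective (simple_list_simple t) sM fv.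
Qed.

Lemma ex_iso_of_x_killed (i : nat) (M : lmodType D) (w : M) :
  simple_module M -> w != 0 ->
  highest_weight sc a b g (xi ^+ i) ((-1) ^+ i) w -> x *: w = 0 ->
  exists t, module_iso M (S t).
Proof.
move=> sM w0 [bw aw gw] xw.
have p2 : (0 < 2 * p)%N by rewrite muln_gt0 /= ltnW.
pose i' := Ordinal (ltn_pmod i p2).
have xi' : xi ^+ i' = xi ^+ i by rewrite (prim_expr_mod xi_prim).
have sg : (-1) ^+ i' = (-1) ^+ i :> k.
  by rewrite !sign_xiX mulnC exprM xi' -exprM mulnC.
rewrite -xi' in aw; rewrite -sg in gw.
have [f fw] := K_hom aw bw gw xw.
have fw0 : f (Kb i') != 0 by rewrite fw.
by exists (inl i'); exact: (iso_of_hom (t := inl i') sM fw0).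
Qed.

(** The relation x^2 = 1 - g^2 on V_{i,j}, read on the entries: the two powers of
    xi multiply to xi^(2p) = 1. *)
Lemma V_x_entriesM (i j : nat) :
  theta * xi ^+ (p + 1 + i) * ((-1) ^+ i - xi ^+ j)
    * (theta^-1 * xi ^ (p%:Z - 1 - i%:Z) * ((-1) ^+ i + xi ^+ j))
  = 1 - xi ^+ j ^+ 2.
Proof.
have xiV : xi ^+ (p + 1 + i) * xi ^ (p%:Z - 1 - i%:Z) = 1.
  rewrite (exprnP xi (p + 1 + i)) -expfzDr ?(xi_neq0 p_ge2 xi_prim) //.
  rewrite (_ : _ + _ = (2 * p)%N%:Z); first exact: prim_expr_order xi_prim.
  by rewrite mul2n -addnn !PoszD; ring.
transitivity ((theta * theta^-1) * (xi ^+ (p + 1 + i) * xi ^ (p%:Z - 1 - i%:Z))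
  * (((-1) ^+ i - xi ^+ j) * ((-1) ^+ i + xi ^+ j))); first by ring.
have t0 := theta_neq0 p_ge2 xi_prim theta2.
by rewrite xiV divff // !mul1r -subr_sqr sqrr_sign.
Qed.

Lemma simple_iso_list (M : lmodType D) : (2 * p)%:R != 0 :> k ->
  simple_module M -> exists t, module_iso M (S t).
Proof.
move=> p0 sM; have [[v v0] _] := sM.
have rels := double_relations p xi theta.
have [i [j [w w0 hw]]] :=
  ex_highest_weight xi_prim (@double_scalarC _ _ _ _) rels p0 v0.
have [axw bxw gxw xxw] :=
  x_highest_weight p_ge2 xi_prim (@double_scalarC _ _ _ _) rels hw.
have [bw aw gw] := hw.
have [ij|ij] := eqVneq ((-1) ^+ i) (xi ^+ j).
  have [xw0|xw0] := eqVneq (x *: w) 0.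
    by apply: (@ex_iso_of_x_killed i _ w); rewrite ?ij.
  (* Now x w has weight exponent i+1, where (-1)^(i+1) = - xi^j again matches. *)
  have hwx : highest_weight sc a b g (xi ^+ i.+1) ((-1) ^+ i.+1) (x *: w).
    split; first by rewrite bxw ij subrr mulr0 rmorph0 scale0r.
      exact: axw.
    by rewrite exprS mulN1r ij; exact: gxw.
  apply: (ex_iso_of_x_killed sM xw0 hwx).
  by rewrite xxw -ij sqrr_sign subrr rmorph0 scale0r.
have lP : (p * i != j %[mod 2 * p])%N.
  by rewrite -(eq_prim_root_expr xi_prim) -sign_xiX.
pose l : Lambda p := exist _ (i, j) lP.
set c := theta * xi ^+ (p + 1 + i) * ((-1) ^+ i - xi ^+ j) in bxw.
have [xi0 t0] := (xi_neq0 p_ge2 xi_prim, theta_neq0 p_ge2 xi_prim theta2).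
have c0 : c != 0 by rewrite !mulf_neq0 ?expf_neq0 ?subr_eq0.
pose c' := theta^-1 * xi ^ (p%:Z - 1 - i%:Z) * ((-1) ^+ i + xi ^+ j).
have cc' : c * c' = 1 - xi ^+ j ^+ 2 by apply: V_x_entriesM.
have [u [au bu gu xw xu]] :=
  ex_b_preimage p_ge2 xi_prim (@double_scalarC _ _ _ _) rels hw c0 cc'.
have [f fw] := V_hom aw au bw bu gw gu xw xu.
have fw0 : f (Vb i j 0) != 0 by rewrite fw.
by exists (inr l); exact: (iso_of_hom (t := inr l) sM fw0).
Qed.

Lemma matrix_module_kdim n (A B G X : 'M[k]_n.+1)
  (h : matrix_rels p xi theta A B G X) : has_kdim (matrix_module h) n.+1.
Proof.
exists (fun v => v); split; first by exists (fun v => v).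
by move=> c v w; rewrite matrix_module_scalarE.
Qed.

End SimpleModules.

Theorem theorem3p9 (k : closedFieldType) (k_char0 : [pchar k] =i pred0)
    (p : nat) (p_ge2 : (2 <= p)%N)
    (xi : k) (xi_prim : (2 * p).-primitive_root xi)
    (theta : k) (theta2 : theta ^+ 2 = (1 - xi ^- 2) * lambda xi) :
  [/\ classifies_simples (simple_list p_ge2 xi_prim theta2),
      forall i : 'I_(2 * p),
        has_kdim (simple_list p_ge2 xi_prim theta2 (inl i)) 1,
      forall ij : Lambda p,
        has_kdim (simple_list p_ge2 xi_prim theta2 (inr ij)) 2,
      #|Lambda p| = (4 * p ^ 2 - 2 * p)%N
    & #|{: 'I_(2 * p) + Lambda p}| = (4 * p ^ 2)%N].
Proof.
have p0 : (2 * p)%:R != 0 :> k.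
  rewrite (proj1 (pcharf0P k) k_char0) muln_eq0 /= -lt0n.
  exact: ltnW.
have cardS : #|{: 'I_(2 * p) + Lambda p}| = (4 * p ^ 2)%N.
  rewrite (bij_eq_card (@weight_index_bij p)) card_prod card_ord.
  by rewrite mulnACA mulnn.
split=> //.
- split; [exact: simple_list_simple | exact: simple_list_inj |].
  by move=> M; exact: simple_iso_list.
- by move=> i; apply: matrix_module_kdim.
- by move=> l; apply: matrix_module_kdim.
- by rewrite -cardS card_sum card_ord addKn.
Qed.
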